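(* For any simple undirected graph $\mathcal{G}$ and any integer $k\ge1$, $\theta_k(\mathcal{G})\le\theta_{k+1}(\mathcal{G})$.
   Context: For a simple undirected graph $\mathcal{G}=(\mathcal{V},\mathcal{E})$ with $\mathcal{V}=\{1,\dots,n\}$ and an integer $k\ge1$, $\theta_k(\mathcal{G})$ is the optimal value of the semidefinite program: maximize $\langle I_n,X\rangle=\sum_i X_{ii}$ over real symmetric $n\times n$ matrices $X$ such that $X_{ij}=0$ for all $\{i,j\}\in\mathcal{E}$; the $(n+1)\times(n+1)$ matrix $\begin{pmatrix} k & \mathrm{diag}(X)^\top\\ \mathrm{diag}(X) & X\end{pmatrix}$ is positive semidefinite; $X\ge0$ entrywise; and $X_{ii}\le1$ for all $i$. Here $\mathrm{diag}(X)$ is the vector of diagonal entries of $X$. *)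

(* Defs.v *)
From mathcomp Require Import all_boot all_order all_algebra.
From mathcomp Require Import classical_sets reals.

Set Implicit Arguments.
Unset Strict Implicit.
Unset Printing Implicit Defensive.

Import Order.TTheory GRing.Theory Num.Theory.
Local Open Scope classical_set_scope.
Local Open Scope ring_scope.

Record sgraph (n : nat) := SGraph {
  adj :> rel 'I_n;
  adj_sym : symmetric adj;
  adj_irrefl : irreflexive adj
}.

Definition psdmx (R : realType) (m : nat) (A : 'M[R]_m) : Prop :=
  A^T = A /\ forall u : 'cV[R]_m, 0 <= (u^T *m A *m u) ord0 ord0.

Definition diagv (R : realType) (n : nat) (X : 'M[R]_n) : 'cV[R]_n :=
  \col_i X i i.

Definition bordered (R : realType) (n k : nat) (X : 'M[R]_n) : 'M[R]_(1 + n) :=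
  block_mx (k%:R)%:M (diagv X)^T (diagv X) X.

Definition theta_feasible (R : realType) (n : nat) (G : sgraph n) (k : nat)
    (X : 'M[R]_n) : Prop :=
  [/\ X^T = X,
      forall i j, G i j -> X i j = 0,
      psdmx (bordered k X),
      forall i j, 0 <= X i j &
      forall i, X i i <= 1].

Definition theta_values (R : realType) (n : nat) (G : sgraph n) (k : nat) :
    set R :=
  [set \tr X | X in [set X : 'M[R]_n | theta_feasible G k X]].
Arguments theta_values R {n} G k _.

(* [sup] is meaningful because the values are nonempty and bounded above: see
   [has_sup_theta_values]. *)
Definition theta (R : realType) (n : nat) (G : sgraph n) (k : nat) : R :=
  sup (theta_values R G k).

Lemma has_sup_theta_values (R : realType) (n : nat) (G : sgraph n) (k : nat) :
  has_sup (theta_values R G k).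
Proof.
split.
  exists 0, 0; last by rewrite mxtrace0.
  have d0 : diagv (0 : 'M[R]_n) = 0 by apply/colP => i; rewrite !mxE.
  split; [by rewrite trmx0 | by move=> i j _; rewrite mxE | |
          by move=> i j; rewrite mxE | by move=> i; rewrite mxE ler01].
  rewrite /bordered d0 trmx0; split.
    by rewrite tr_block_mx !trmx0 tr_scalar_mx.
  move=> u; rewrite -[u]vsubmxK tr_col_mx mul_row_block !mulmx0 !addr0.
  rewrite mul_row_col mul0mx addr0 mul_mx_scalar -scalemxAl !mxE.
  rewrite mulr_ge0 ?ler0n // sumr_ge0 // => i _.
  by rewrite !mxE -expr2 sqr_ge0.
exists n%:R => _ [X [_ _ _ _ X1] <-].
have -> : n%:R = \sum_(i < n) (1 : R) by rewrite sumr_const card_ord.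
exact: ler_sum.
Qed.

(* Main.v *)
Require Import Defs.
From mathcomp Require Import all_boot all_order all_algebra reals.
Import Order.TTheory GRing.Theory Num.Theory.
Local Open Scope ring_scope.

(** Passing from [k] to [k.+1] adds to the bordered matrix only a 1 in its top-left corner, a
    positive semidefinite term; the other constraints do not mention [k]. So every feasible [X]
    stays feasible with the same trace ([theta_feasibleS]), and the supremum is taken over a larger
    set. *)

Lemma bordered_succ (R : realType) (n k : nat) (X : 'M[R]_n) :
  bordered k.+1 X = bordered k X + block_mx 1%:M 0 0 0.
Proof. by rewrite /bordered add_block_mx !addr0 -natr1 raddfD. Qed.

(** The quadratic form at [u] is the square of the first coordinate of [u]. *)
Lemma psdmx_corner1 (R : realType) (n : nat) :
  psdmx (block_mx 1%:M 0 0 0 : 'M[R]_(1 + n)).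
Proof.
split=> [|u]; first by rewrite tr_block_mx !trmx0 tr_scalar_mx.
rewrite -[u]vsubmxK tr_col_mx mul_row_block !mulmx0 !addr0 mulmx1.
rewrite mul_row_col mul0mx addr0 mxE sumr_ge0 // => i _.
by rewrite mxE -expr2 sqr_ge0.
Qed.

Lemma psdmxD (R : realType) (m : nat) (A B : 'M[R]_m) :
  psdmx A -> psdmx B -> psdmx (A + B).
Proof.
move=> [symA posA] [symB posB]; split=> [|u]; first by rewrite raddfD /= symA symB.
by rewrite mulmxDr mulmxDl mxE addr_ge0.
Qed.

Lemma theta_feasibleS (R : realType) (n : nat) (G : sgraph n) (k : nat)
    (X : 'M[R]_n) :
  theta_feasible G k X -> theta_feasible G k.+1 X.
Proof.
case=> symX XG psdX X0 X1; split=> //.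
by rewrite bordered_succ; apply: psdmxD psdX (psdmx_corner1 R n).
Qed.

Theorem lemma3p3 (R : realType) (n : nat) (G : sgraph n) (k : nat)
    (hk : (1 <= k)%N) : theta R G k <= theta R G k.+1.
Proof.
have [values_neq0 _] := has_sup_theta_values R G k.
apply: ge_sup => // _ [X feasX <-].
(* [sup] dominates its set only when that set is nonempty and bounded above, here the values for
   [k.+1]. *)
apply: sup_upper_bound; first exact: has_sup_theta_values.
by exists X => //; apply: theta_feasibleS.
Qed.
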